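(* In the setting of the context, let $u\in\mathcal B_R$ and suppose that for every $k\in\mathbb N$ there is a set $\tilde U(u,k)\subset\mathbb R^d$ (anti-leaf set) and constants $C_{\tilde U}(u,k)$, $\tilde d_{\max}(u,k)$ such that $\{\|v(t_k)-u(t_k)\|_1: v\in\tilde U(u,k)\}=[0,\tilde d_{\max}(u,k)]$ and for every $v\in\tilde U(u,k)$, $$\sum_{i=0}^k\|v(t_i)-u(t_i)\|_1\le C_{\tilde U}(u,k)\cdot\|v(t_k)-u(t_k)\|_1 ,$$ and that there are infinitely many indices $i_1<i_2<\ldots$ such that for every $i_j$, $C_{\tilde U}(u,i_j)\le C_{\tilde U}(u)$ and $\tilde d_{\max}(u,i_j)\ge\tilde d_{\max}(u)$ for some constants $C_{\tilde U}(u)<\infty$ and $\tilde d_{\max}(u)>0$. Suppose the observation matrix is $H$, the observation noise is uniformly distributed in $[-\epsilon,\epsilon]^{d_o}$, and the prior satisfies $q(v)>0$ for every $v\in\bigcup_{k\in\mathbb N}\tilde U(u,k)$. Then for any $0<\epsilon\le\tilde d_{\max}(u)\,C_{\tilde U}(u)\,\|H\|_1$ and any $j\ge1$, $$\mathbb E\big[\mathrm{diam}_1\,\mathrm{supp}\,\mu^{\mathrm{fi}}(\cdot\,|Y_0,\ldots,Y_{i_j})\,\big|\,u\big]\ge\frac1e\cdot\frac{\epsilon}{C_{\tilde U}(u)\,\|H\|_1},$$ where $\mathrm{diam}_1\,\mathrm{supp}$ denotes the diameter of the support with respect to the $L_1$ norm.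
   Context: Dynamics: $\frac{du}{dt}=-Au-B(u,u)+f$ on $\mathbb R^d$, with $A$ a linear operator, $B:\mathbb R^d\times\mathbb R^d\to\mathbb R^d$ bilinear, $f\in\mathbb R^d$. For $v\in\mathbb R^d$, $v(t)=\Psi_t(v)$ is the solution with $v(0)=v$. Trapping ball assumption: there are $R,\delta>0$ with $\langle -Av-B(v,v)+f,v\rangle\le0$ whenever $\|v\|\in[R,R+\delta]$. $\mathcal B_R=\{v:\|v\|\le R\}$; for $v\in\mathcal B_R$ the solution exists for all $t\ge0$ and stays in $\mathcal B_R$, and $\Psi_t$ is one-to-one from $\mathcal B_R$ onto $\Psi_t(\mathcal B_R)$ with inverse denoted $\Psi_{-t}$. Observations: $t_i=ih$ with fixed $h>0$, $Y_i=Hu(t_i)+Z_i$, $H\in\mathbb R^{d_o\times d}$, $Z_i$ i.i.d. with density $\eta$. The prior $q$ is a probability density on $\mathbb R^d$ vanishing outside $\mathcal B_R$. The filtering density (conditional density of $u(t_k)$ given $Y_0,\ldots,Y_k$) is $\mu^{\mathrm{fi}}(v|Y_0,\ldots,Y_k)\propto\left[\prod_{i=0}^k\eta(Y_i-H\Psi_{t_i-t_k}(v))\right]\det(J\Psi_{-t_k}(v))\,q(\Psi_{-t_k}(v))$ for $v\in\Psi_{t_k}(\mathcal B_R)$ (here $\Psi_{t_i-t_k}(v)=\Psi_{t_i}(\Psi_{-t_k}(v))$ and $J$ denotes the Jacobian matrix), and $0$ otherwise; its support is the set of points where it is nonzero. $\mathbb E[\cdot|u]$ is expectation over the noise with true initial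 point $u$. $\|v\|_1=\sum_i|v_i|$ and $\|H\|_1$ is the operator norm induced by $\|\cdot\|_1$. *)

(* Defs.v *)
From HB Require Import structures.
From mathcomp Require Export all_boot all_order all_algebra.
From mathcomp Require Export all_classical all_reals all_analysis.

Set Implicit Arguments.
Unset Strict Implicit.
Unset Printing Implicit Defensive.

Export Order.TTheory GRing.Theory Num.Theory.
Export numFieldNormedType.Exports.

Local Open Scope classical_set_scope.
Local Open Scope ring_scope.

(* Vectors of R^n are row vectors, so the matrix H acts by u |-> u *m H^T. *)

Section Norms.
Context {R : realType}.

Definition inner n (v w : 'rV[R]_n) : R := \sum_(i < n) v 0 i * w 0 i.

Definition norm2 n (v : 'rV[R]_n) : R := Num.sqrt (inner v v).

Definition norm1 n (v : 'rV[R]_n) : R := \sum_(i < n) `|v 0 i|.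

Definition eball n (r : R) : set 'rV[R]_n := [set v | norm2 v <= r].

Definition opnorm1 m n (H : 'M[R]_(m, n)) : R :=
  sup [set norm1 (v *m H^T) | v in [set v : 'rV[R]_n | norm1 v <= 1]].

(* [sup] is real-valued: it is 0 on the empty set, and it is the supremum on
   nonempty bounded sets. *)
Definition diam1 n (S : set 'rV[R]_n) : R :=
  sup [set norm1 (p.1 - p.2) | p in S `*` S].

End Norms.

Section Densities.
Context {R : realType}.

(* R^n with its Borel sigma-algebra. *)
Definition borelV n := g_sigma_algebraType (@open 'rV[R]_n).

(* Lebesgue integral over R^n, as an iterated integral (Tonelli); only meant
   for nonnegative Borel functions. *)
Fixpoint integral_rV n : ('rV[R]_n -> \bar R) -> \bar R :=
  match n with
  | 0 => fun g => g 0
  | n'.+1 => fun g =>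
      (\int[lebesgue_measure]_(x in [set: R])
        integral_rV (fun v : 'rV[R]_n' => g (row_mx (x%:M : 'rV_1) v)))%E
  end.

Definition is_density n (q : 'rV[R]_n -> R) :=
  [/\ forall v, 0 <= q v,
      measurable_fun [set: borelV n] (q : borelV n -> R) &
      integral_rV (fun v => (q v)%:E) = 1%E].

Definition uniform_density m (eps : R) (z : 'rV[R]_m) : R :=
  \prod_(j < m) uniform_pdf (- eps) eps (z 0 j).

End Densities.

Section Noise.
Context {R : realType} {dT : measure_display} {T : measurableType dT}.

Definition has_density (P : probability T R) m
    (X : {RV P >-> @borelV R m}) (eta : 'rV[R]_m -> R) :=
  forall E : set (@borelV R m), measurable E ->
    distribution P X E = integral_rV (fun z => (eta z * \1_E z)%:E).

Definition mutually_independent (P : probability T R) dT'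
    (T' : measurableType dT') (X : nat -> {RV P >-> T'}) :=
  forall (J : seq nat) (E : nat -> set T'),
    uniq J -> (forall i, measurable (E i)) ->
    P (\bigcap_(i in [set` J]) X i @^-1` E i) =
      (\prod_(i <- J) P (X i @^-1` E i))%E.

End Noise.

Arguments has_density {R dT T} P {m} X eta.
Arguments mutually_independent {R dT T} P {dT' T'} X.

Section Dynamics.
Context {R : realType} {n : nat}.
Variables (A : {linear 'rV[R]_n -> 'rV[R]_n})
  (B : {bilinear 'rV[R]_n -> 'rV[R]_n -> 'rV[R]_n}) (f : 'rV[R]_n).

Definition vfield (v : 'rV[R]_n) : 'rV[R]_n := - A v - B v v + f.

(* Forward solutions; the values of [x] at negative times are irrelevant. *)
Definition solution (v : 'rV[R]_n) (x : R -> 'rV[R]_n) :=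
  [/\ x 0 = v,
      {within `[0, +oo[, continuous x} &
      forall t : R, 0 < t -> is_derive t (1 : R) x (vfield (x t))].

(* The solution map Psi_t, for t >= 0. *)
Definition flow (t : R) (v : 'rV[R]_n) : 'rV[R]_n :=
  xget (fun=> 0) [set x | solution v x] t.

Definition trapping (r delta : R) :=
  forall v, r <= norm2 v <= r + delta -> inner (vfield v) v <= 0.

(* Psi_{-t}, the inverse of Psi_t from Psi_t(B_r) to B_r. *)
Definition flow_inv (r t : R) : 'rV[R]_n -> 'rV[R]_n :=
  'pinv_(fun=> 0) (eball r) (flow t).

(* Psi_{-t} is only defined on Psi_t(B_r), hence its Jacobian at a point w of
   this set is that of its differential at w relative to the set. *)
Definition flow_inv_jacobian (r t : R) (w : 'rV[R]_n) : 'M[R]_n :=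
  lin1_mx ('d (flow_inv r t) (within (flow t @` eball r) (nbhs w))).

Lemma flow_inv_jacobian_interior (r t : R) (w : 'rV[R]_n) :
  (flow t @` eball r)° w -> flow_inv_jacobian r t w = 'J (flow_inv r t) w.
Proof.
rewrite /flow_inv_jacobian /jacobian; move: (flow_inv r t) (_ @` _) => g D Dw.
congr lin1_mx.
have withinE : within D (nbhs w) = nbhs w.
  apply/predeqP => S; split=> [DS|].
    by apply: (filterS2 _ _ Dw DS) => x Dx; apply.
  by apply: filterS => x Sx _.
have diffE (F G : filter_on 'rV[R]_n) : filter F = filter G ->
    diff (Phantom _ (filter F)) g = diff (Phantom _ (filter G)) g.
  case: F G => F HF [G HG] /= FG; subst G.
  by rewrite (Prop_irrelevance HF HG).
exact: (congr1 (fun L : {linear _ -> _} => L : _ -> _)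
  (diffE (within_filter_on D (nbhs_filter_on w)) (nbhs_filter_on w) withinE)).
Qed.

Definition obs_time (h : R) (i : nat) : R := i%:R * h.

(* Unnormalised filtering density; Y is the tuple of observations. *)
Definition filtering_weight m (r h : R) (H : 'M[R]_(m, n))
    (eta : 'rV[R]_m -> R) (q : 'rV[R]_n -> R)
    k (Y : 'I_k.+1 -> 'rV[R]_m) (w : 'rV[R]_n) : R :=
  let v0 := flow_inv r (obs_time h k) w in
  if w \in flow (obs_time h k) @` eball r then
    (\prod_(i < k.+1) eta (Y i - flow (obs_time h i) v0 *m H^T)) *
    \det (flow_inv_jacobian r (obs_time h k) w) * q v0
  else 0.

(* The normalising constant may depend on the observations. *)
Definition is_filtering_density m (r h : R) (H : 'M[R]_(m, n))
    (eta : 'rV[R]_m -> R) (q : 'rV[R]_n -> R)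
    (mu : forall k, ('I_k.+1 -> 'rV[R]_m) -> 'rV[R]_n -> R) :=
  forall k (Y : 'I_k.+1 -> 'rV[R]_m), exists2 c : R, 0 < c &
    forall w, mu k Y w = c * filtering_weight r h H eta q Y w.

End Dynamics.

Definition density_supp {R : realType} n (p : 'rV[R]_n -> R) : set 'rV[R]_n :=
  [set v | p v != 0].

(* Main.v *)
Require Import Defs.
From mathcomp Require Import ring lra measurable_realfun.

(** The proof compares the true initial point [u] with one other initial point.
    Let [k] be the index [idx j] and [rho := eps / (CU * opnorm1 H)]. Since
    [rho <= dU <= dmax k], the anti-leaf set [U k] contains a point [v] with
    [norm1 (v(t_k) - u(t_k)) = rho], and by the anti-leaf inequality the noiseless
    observations of [u] and [v] at the times [t_0, ..., t_k] differ in total by at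
    most [opnorm1 H * CU * rho = eps] in the 1-norm.

    The density of the noise is positive on [[-eps, eps]^m], so both [u(t_k)] and
    [v(t_k)] have positive likelihood as soon as every coordinate of every [Z i]
    stays in [[-eps, eps]] after a shift by the difference [a_i] of the two
    noiseless observations as well as without it. By independence this event has
    probability [\prod_(i, l) (1 - |a_il| / (2 eps))], which is at least
    [1 - eps / (2 eps) = 1/2], because the [|a_il|] add up to at most [eps]
    ([prob_overlap]). On it the support has diameter at least [rho]
    ([filtering_supp], [le_diam1]), so the expected diameter is at least
    [rho / 2], and [1/2 >= 1/e].

    The analytic part of the proof is to show that such a point really is in the
    support, which requires the Jacobian factor of the filtering density to be
    nonzero, also at images of boundary points of the ball
    ([det_flow_inv_jacobian]). The trapping condition keeps solutions in the ball
    ([flow_eball]), where the quadratic vector field is Lipschitz. A two-sided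
    Gronwall inequality ([gronwall]), applied to linear combinations of
    differences of solutions ([flow_combination]), shows that difference quotients
    of the flow converge, that the limit is linear, and that it is injective: this
    takes the place of solving the linearized equation. The inverse flow then has
    an invertible differential relative to the image of the ball
    ([det_inverse_differential]). The same inequality shows that the flow is
    injective, which is how [u] itself is recognised as a point of [U k], so that
    the prior is positive at [u]. *)

Set Implicit Arguments.
Unset Strict Implicit.
Unset Printing Implicit Defensive.

Local Open Scope classical_set_scope.
Local Open Scope ring_scope.

(** * Norms and bounded linear maps *)

Section Norms.
Context {R : realType} {n : nat}.
Implicit Types v w : 'rV[R]_n.

Lemma coord_le_norm v i : `|v 0 i| <= `|v|.
Proof.
rewrite [leRHS]/Num.Def.normr/= mx_normrE.
by apply: (le_bigmax _ (fun ij => `|v ij.1 ij.2|) (0, i)).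
Qed.

Lemma norm_le_coord v (c : R) : 0 <= c -> (forall i, `|v 0 i| <= c) -> `|v| <= c.
Proof.
move=> c0 vc; rewrite /Num.Def.normr/= mx_normrE (bigmax_le _ c0)//= => -[i j] _ /=.
by rewrite ord1.
Qed.

Lemma innerC v w : inner v w = inner w v.
Proof. by apply: eq_bigr => i _; rewrite mulrC. Qed.

Lemma innerDl u v w : inner (u + v) w = inner u w + inner v w.
Proof. by rewrite /inner -big_split; apply: eq_bigr => i _; rewrite mxE mulrDl. Qed.

Lemma innerZl a v w : inner (a *: v) w = a * inner v w.
Proof. by rewrite /inner mulr_sumr; apply: eq_bigr => i _; rewrite mxE mulrA. Qed.

Lemma innervv_ge0 v : 0 <= inner v v.
Proof. by apply: sumr_ge0 => i _; rewrite -expr2 sqr_ge0. Qed.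

Lemma norm_inner_le v w : `|inner v w| <= n%:R * (`|v| * `|w|).
Proof.
rewrite (le_trans (ler_norm_sum _ _ _))//.
rewrite (@le_trans _ _ (\sum_(i < n) `|v| * `|w|))//.
  by apply: ler_sum => i _; rewrite normrM ler_pM// coord_le_norm.
by rewrite sumr_const card_ord mulr_natl.
Qed.

Lemma sqr_norm_le_inner v : `|v| ^+ 2 <= inner v v.
Proof.
have iv0 := innervv_ge0 v.
suff : `|v| <= Num.sqrt (inner v v) by rewrite -(@ler_pXn2r _ 2)// ?nnegrE ?sqrtr_ge0// sqr_sqrtr.
apply: norm_le_coord => [|i]; first exact: sqrtr_ge0.
rewrite -sqrtr_sqr ler_wsqrtr// /inner (bigD1 i)//= expr2 lerDl.
by apply: sumr_ge0 => k _; rewrite -expr2 sqr_ge0.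
Qed.

Lemma eball_inner (r : R) v : 0 <= r -> eball r v <-> inner v v <= r ^+ 2.
Proof.
move=> r0; rewrite /eball /norm2 /= -{1}(ger0_norm r0) -sqrtr_sqr ler_sqrt//.
by rewrite sqr_ge0.
Qed.

Lemma eball_norm (r : R) v : 0 <= r -> eball r v -> `|v| <= r.
Proof.
move=> r0 /(eball_inner _ r0) vr.
by rewrite -(@ler_pXn2r _ 2)// ?nnegrE// (le_trans (sqr_norm_le_inner v)).
Qed.

Lemma eball_convex (r s : R) v w : 0 <= r -> 0 <= s <= 1 ->
  eball r v -> eball r w -> eball r (v + s *: (w - v)).
Proof.
move=> r0 /andP[s0 s1] /(eball_inner _ r0) vr /(eball_inner _ r0) wr.
apply/eball_inner => //.
have -> : v + s *: (w - v) = (1 - s) *: v + s *: w.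
  by rewrite scalerBr scalerBl scale1r addrA addrAC.
have key : 2 * inner v w <= inner v v + inner w w.
  rewrite /inner mulr_sumr -big_split/=; apply: ler_sum => i _.
  rewrite -!expr2 mulrA -subr_ge0.
  by rewrite (_ : _ - _ = (v 0 i - w 0 i) ^+ 2) ?sqr_ge0// sqrrB; ring.
rewrite innerDl !innerZl innerC [X in s * X]innerC !innerDl !innerZl.
rewrite (innerC w v).
have st : 0 <= s * (1 - s) by rewrite mulr_ge0// subr_ge0.
have := ler_wpM2l st key.
nra.
Qed.

Lemma norm_norm1 v : `|v| <= norm1 v.
Proof.
apply: norm_le_coord => [|i]; first by apply: sumr_ge0.
by rewrite /norm1 (bigD1 i)//= lerDl sumr_ge0.
Qed.

Lemma norm1_norm v : norm1 v <= n%:R * `|v|.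
Proof.
rewrite mulr_natl -[X in _ *+ X]card_ord -sumr_const.
by apply: ler_sum => i _; exact: coord_le_norm.
Qed.

End Norms.

Section LinearBounds.
Context {R : realType}.

Lemma linear_bounded n m (A : {linear 'rV[R]_n -> 'rV[R]_m}) :
  exists2 a : R, 0 <= a & forall v, `|A v| <= a * `|v|.
Proof.
exists (\sum_(i < n) `|A (delta_mx 0 i)|); first by apply: sumr_ge0.
move=> v; rewrite {1}(row_sum_delta v) linear_sum (le_trans (ler_norm_sum _ _ _))//.
rewrite mulr_suml ler_sum// => i _.
by rewrite linearZ/= normrZ mulrC ler_wpM2l// coord_le_norm.
Qed.

Lemma bilinear_bounded n m (B : {bilinear 'rV[R]_n -> 'rV[R]_n -> 'rV[R]_m}) :
  exists2 b : R, 0 <= b & forall v w, `|B v w| <= b * (`|v| * `|w|).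
Proof.
exists (\sum_(i < n) \sum_(j < n) `|B (delta_mx 0 i) (delta_mx 0 j)|).
  by apply: sumr_ge0 => i _; apply: sumr_ge0.
move=> v w; rewrite {1}(row_sum_delta v) linear_sumlz (le_trans (ler_norm_sum _ _ _))//.
rewrite mulr_suml ler_sum// => i _.
rewrite linearZl_LR/= normrZ {1}(row_sum_delta w) linear_sum.
rewrite (le_trans (ler_wpM2l _ (ler_norm_sum _ _ _)))// mulr_sumr mulr_suml ler_sum// => j _.
rewrite linearZ/= normrZ mulrA mulrC.
by rewrite ler_wpM2l// ler_pM// coord_le_norm.
Qed.

End LinearBounds.

(** * Gronwall inequalities *)

Lemma continuous_sum {R : numFieldType} {T : topologicalType} {V : normedModType R}
    I (s : seq I) (F : I -> T -> V) :
  (forall i, continuous (F i)) -> continuous (fun x => \sum_(i <- s) F i x).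
Proof.
move=> cF x; elim: s => [|i s IH].
  by under eq_fun do rewrite big_nil; exact: cvg_cst.
under eq_fun do rewrite big_cons.
by apply: cvgD => //; exact: cF.
Qed.

Section CurvesInRn.
Context {R : realType} {n : nat}.
Implicit Types (E : R -> 'rV[R]_n).

Lemma continuous_inner : continuous (fun v : 'rV[R]_n => inner v v).
Proof.
apply: continuous_sum => i v.
have ci := @coord_continuous R 1 n 0 i v; exact: (cvgM ci ci).
Qed.

Lemma within_continuous_inner (D : set R) E :
  {within D, continuous E} -> {within D, continuous (fun t => inner (E t) (E t))}.
Proof.
move=> cE x.
exact: (@continuous_comp (subspace D) _ _ E (fun v => inner v v) x (cE x) (@continuous_inner (E x))).
Qed.

Lemma is_derive_coord E (t : R) l i :
  is_derive t 1 E l -> is_derive t 1 (fun s => E s 0 i) (l 0 i).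
Proof.
move=> [dE El]; split; first by move/derivable_mxP : dE; apply.
by move: El; rewrite derive_mx// => /rowP/(_ i); rewrite mxE.
Qed.

Lemma is_derive_inner E (t : R) l :
  is_derive t 1 E l ->
  is_derive t 1 (fun s => inner (E s) (E s)) (2 * inner (E t) l).
Proof.
move=> dE; rewrite /inner.
have -> : (fun s => \sum_(i < n) E s 0 i * E s 0 i) =
    \sum_(i < n) ((fun s => E s 0 i) * (fun s => E s 0 i)).
  by apply/funext => s; rewrite fct_sumE.
have -> : 2 * (\sum_(i < n) E t 0 i * l 0 i) =
    \sum_(i < n) (E t 0 i *: l 0 i + E t 0 i *: l 0 i).
  by rewrite mulr_sumr; apply: eq_bigr => i _; rewrite /GRing.scale/=; ring.
apply: is_derive_sum => i.
have di := is_derive_coord i dE; exact: is_deriveM.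
Qed.

End CurvesInRn.

Section Gronwall.
Context {R : realType}.

Lemma is_derive_expR_mul (g : R -> R) (c t l : R) : is_derive t 1 g l ->
  is_derive t 1 (fun s => expR (c * s) * g s) (expR (c * t) * (c * g t + l)).
Proof.
move=> dg.
have de : is_derive t 1 (fun s => expR (c * s)) (c * expR (c * t)).
  have d1 : is_derive t 1 (fun s => c * s) c.
    have := @is_deriveZ R R R id c t 1 1 (is_derive_id _ _).
    by rewrite /GRing.scale/= mulr1.
  rewrite mulrC; exact: (@is_derive1_comp R expR _ t _ _ (is_derive_expR _) d1).
have -> : expR (c * t) * (c * g t + l) = expR (c * t) *: l + g t *: (c * expR (c * t)).
  by rewrite /GRing.scale/=; ring.
exact: is_deriveM.
Qed.

Lemma within_continuous_expR_mul (D : set R) (g : R -> R) (c : R) :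
  {within D, continuous g} -> {within D, continuous (fun s => expR (c * s) * g s)}.
Proof.
move=> cg.
have ce : continuous (fun s : R => expR (c * s)).
  move=> x; apply: (@continuous_comp R R R (fun s => c * s) expR).
    by apply: cvgM; [exact: cvg_cst | exact: cvg_id].
  exact: continuous_expR.
have ce' : {within D, continuous (fun s : R => expR (c * s))}.
  exact: continuous_subspaceT.
move=> x; exact: (@continuousM R (subspace D) (fun s => expR (c * s)) g x (ce' x) (cg x)).
Qed.

(** The two bounds say that [exp (- k t) g t] decreases and [exp (k t) g t]
    increases. The reverse bound is what controls the flow backwards in time,
    although solutions are only available forwards. *)
Lemma gronwall_scalar (g g' : R -> R) (k T : R) :
  {within `[0, T], continuous g} ->
  (forall t, 0 < t < T -> is_derive t 1 g (g' t)) ->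
  (forall t, 0 < t < T -> `|g' t| <= k * g t) ->
  forall t, 0 <= t <= T -> g t <= expR (k * t) * g 0 /\ g 0 <= expR (k * t) * g t.
Proof.
move=> cg dg g'k t /andP[t0 tT].
have T0 : 0 <= T by exact: le_trans tT.
have i0 : 0 \in `[0, T] by rewrite in_itv/= lexx.
have it : t \in `[0, T] by rewrite in_itv/= t0.
have dE (c x : R) : x \in `]0, T[ -> derive1 (fun s => expR (c * s) * g s) x
    = expR (c * x) * (c * g x + g' x).
  by rewrite in_itv/= derive1E => /dg/(is_derive_expR_mul c)[_ ->].
have dE' (c x : R) : x \in `]0, T[ -> derivable (fun s => expR (c * s) * g s) x 1.
  by rewrite in_itv/= => /dg/(is_derive_expR_mul c)[].
split.
  have /= := @ler0_derive1_le_cc R _ 0 T (dE' (- k)) _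
    (@within_continuous_expR_mul _ _ (- k) cg) t 0 it i0 t0.
  rewrite mulr0 expR0 mul1r mulNr expRN ler_pdivrMl ?expR_gt0//; apply=> x xT.
  rewrite dE// pmulr_rle0 ?expR_gt0//.
  by move: xT; rewrite in_itv/= => /g'k /ler_normlP[]; lra.
have /= := @ger0_derive1_le_cc R _ 0 T (dE' k) _
  (@within_continuous_expR_mul _ _ k cg) 0 t i0 it t0.
rewrite mulr0 expR0 mul1r; apply=> x xT.
rewrite dE// pmulr_rge0 ?expR_gt0//.
by move: xT; rewrite in_itv/= => /g'k /ler_normlP[]; lra.
Qed.

(** The scalar inequality is applied to [|E|^2 + c^2], with the Euclidean norm,
    which is differentiable everywhere: the derivative [2 <E, E'>] is at most
    [n (2k|E|^2 + 2c|E|)] in the sup norm, and [2c|E| <= |E|^2 + c^2]. The constant [K] depends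
    only on [n], [k] and [T], which makes all later estimates uniform in the
    initial points. *)
Lemma gronwall n (k T : R) : 0 <= k -> exists2 K : R, 0 < K &
  forall (E E' : R -> 'rV[R]_n) (c : R), 0 <= c ->
  {within `[0, T], continuous E} ->
  (forall t, 0 < t < T -> is_derive t 1 E (E' t)) ->
  (forall t, 0 < t < T -> `|E' t| <= k * `|E t| + c) ->
  forall t, 0 <= t <= T ->
    `|E t| <= K * (`|E 0| + c) /\ `|E 0| <= K * (`|E t| + c).
Proof.
move=> k0; set kn := n%:R * (2 * k + 1).
have kn0 : 0 <= kn by rewrite mulr_ge0// addr_ge0// mulr_ge0.
exists (expR (kn * T) * (n%:R + 1)).
  by rewrite mulr_gt0 ?expR_gt0// ltr_wpDl.
move=> E E' c c0 cE dE E'k t t0T.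
have T0 : 0 <= T by case/andP: t0T => ?; apply: le_trans.
pose g t := inner (E t) (E t) + c ^+ 2.
have g'b s : 0 < s < T -> `|2 * inner (E s) (E' s)| <= kn * g s.
  move=> sT; rewrite normrM ger0_norm// /g.
  have Ein := sqr_norm_le_inner (E s).
  have E'in := norm_inner_le (E s) (E' s).
  have Es0 := normr_ge0 (E s).
  have n0 : 0 <= n%:R :> R by [].
  have := ler_wpM2l Es0 (E'k s sT) => EE'.
  have {}EE' : 2 * (`|E s| * `|E' s|) <= (2 * k + 1) * (inner (E s) (E s) + c ^+ 2).
    have := sqr_ge0 (`|E s| - c); have := mulr_ge0 k0 (sqr_ge0 c).
    have := ler_wpM2l k0 Ein; nra.
  have := ler_wpM2l n0 EE'; rewrite /kn; lra.
have [|s sT|gt g0] := @gronwall_scalar g (fun s => 2 * inner (E s) (E' s)) kn T _ _ g'b t t0T.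
- have cE2 := within_continuous_inner cE.
  have cc : {within `[0, T], continuous (fun=> c ^+ 2)}.
    by apply: continuous_subspaceT => x; exact: cvg_cst.
  move=> x; exact: (@continuousD R R (subspace `[0, T]) (fun t => inner (E t) (E t))
    (fun=> c ^+ 2) x (cE2 x) (cc x)).
- rewrite -[X in is_derive _ _ _ X]addr0; have := is_derive_inner (dE s sT) => ?.
  exact: is_deriveD.
have in_le (v : 'rV[R]_n) : inner v v <= n%:R * `|v| ^+ 2.
  by rewrite expr2 (le_trans (ler_norm _))// norm_inner_le.
have ent : expR (kn * t) <= expR (kn * T).
  by rewrite ler_expR ler_wpM2l//; case/andP: t0T.
have eT1 : 1 <= expR (kn * T) by rewrite -expR0 ler_expR mulr_ge0.
have key (x y : R) : 0 <= x -> 0 <= y ->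
    x ^+ 2 <= expR (kn * T) * (n%:R * y ^+ 2 + c ^+ 2) ->
    x <= expR (kn * T) * (n%:R + 1) * (y + c).
  set K := _ * (n%:R + 1) => x0 y0 xy.
  have n0 : 0 <= n%:R :> R by [].
  have K1 : 1 <= K by rewrite -[leLHS]mulr1 ler_pM// lerDr.
  have K0 : 0 <= K by exact: le_trans K1.
  rewrite -(@ler_pXn2r _ 2)// ?nnegrE ?mulr_ge0 ?addr_ge0//.
  apply: (le_trans xy); apply: (@le_trans _ _ (K * (y + c) ^+ 2)).
    rewrite /K -mulrA ler_wpM2l ?expR_ge0//.
    have := mulr_ge0 y0 c0; have := mulr_ge0 n0 (mulr_ge0 y0 c0).
    have := mulr_ge0 n0 (sqr_ge0 c); have := sqr_ge0 y; lra.
  by rewrite exprMn ler_wpM2r ?sqr_ge0// expr2 ler_peMr.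
have gge0 s : 0 <= g s by rewrite addr_ge0// ?innervv_ge0// sqr_ge0.
split; apply: key => //.
- apply: (le_trans (sqr_norm_le_inner _)).
  rewrite (@le_trans _ _ (g t)) ?lerDl ?sqr_ge0// (le_trans gt)//.
  by rewrite ler_pM ?expR_ge0// lerD2r.
- apply: (le_trans (sqr_norm_le_inner _)).
  rewrite (@le_trans _ _ (g 0)) ?lerDl ?sqr_ge0// (le_trans g0)//.
  by rewrite ler_pM ?expR_ge0// lerD2r.
Qed.

End Gronwall.

(** * Trapping and stability of the flow *)

Section Sums.
Context {R : realType} {V : normedModType R} {I : eqType}.

Lemma is_derive_sum_seq (s : seq I) (F : I -> R -> V) (F' : I -> V) (t : R) :
  {in s, forall i, is_derive t 1 (F i) (F' i)} ->
  is_derive t 1 (fun x => \sum_(i <- s) F i x) (\sum_(i <- s) F' i).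
Proof.
elim: s => [_|i s IH dF].
  rewrite big_nil (_ : (fun _ => _) = cst 0); first exact: is_derive_cst.
  by apply/funext => x; rewrite big_nil.
rewrite big_cons (_ : (fun _ => _) = F i + (fun x => \sum_(j <- s) F j x)); last first.
  by apply/funext => x; rewrite big_cons.
have di : is_derive t 1 (F i) (F' i) by apply: dF; exact: mem_head.
have ds : is_derive t 1 (fun x => \sum_(j <- s) F j x) (\sum_(j <- s) F' j).
  by apply: IH => j js; apply: dF; rewrite in_cons js orbT.
exact: is_deriveD.
Qed.

Lemma within_continuous_sum (D : set R) (s : seq I) (F : I -> R -> V) :
  {in s, forall i, {within D, continuous (F i)}} ->
  {within D, continuous (fun x => \sum_(i <- s) F i x)}.
Proof.
elim: s => [_|i s IH cF].
  under eq_fun do rewrite big_nil.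
  by apply: continuous_subspaceT => x; exact: cvg_cst.
under eq_fun do rewrite big_cons.
have ci : {within D, continuous (F i)} by apply: cF; exact: mem_head.
have cs : {within D, continuous (fun x => \sum_(j <- s) F j x)}.
  by apply: IH => j js; apply: cF; rewrite in_cons js orbT.
move=> x; exact: (@continuousD R V (subspace D) (F i) _ x (ci x) (cs x)).
Qed.

Lemma within_continuousZB (D : set R) (a : R) (f g : R -> V) :
  {within D, continuous f} -> {within D, continuous g} ->
  {within D, continuous (fun x => a *: (f x - g x))}.
Proof.
move=> cf cg.
have cfg : {within D, continuous (fun x => f x - g x)}.
  move=> x; exact: (@continuousB R V (subspace D) f g x (cf x) (cg x)).
have ca : {within D, continuous (fun=> a)}.
  by apply: continuous_subspaceT => x; exact: cvg_cst.
move=> x; exact: (@continuousZ R V (subspace D) (fun=> a) (fun x => f x - g x) x (ca x) (cfg x)).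
Qed.

End Sums.

Section Trapping.
Context {R : realType}.

Lemma within_continuous_dist (D : set R) (g : R -> R) (s e : R) :
  {within D, continuous g} -> D s -> 0 < e ->
  exists2 eta, 0 < eta & forall t, D t -> `|s - t| < eta -> `|g s - g t| < e.
Proof.
move=> /subspace_continuousP cg Ds e0.
have /cvgrPdist_lt/(_ e e0) := cg s Ds.
rewrite near_withinE near_simpl => /nbhs_ballP[eta /= eta0 H].
by exists eta => // t Dt st; exact: H.
Qed.

(** If [g] exceeded [lo] at time [t], then after the last time [s0] before [t]
    at which [g <= lo] there would be an interval on which [g] lies in
    [(lo, hi)]; there [g] decreases, so it could not have left [lo]. *)
Lemma barrier (g g' : R -> R) (lo hi : R) : lo < hi ->
  {within `[0, +oo[, continuous g} ->
  (forall t : R, 0 < t -> is_derive t 1 g (g' t)) ->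
  (forall t : R, 0 < t -> lo <= g t <= hi -> g' t <= 0) ->
  g 0 <= lo -> forall t : R, 0 <= t -> g t <= lo.
Proof.
move=> lohi cg dg g'le g0 t t0; rewrite leNgt; apply/negP => glo.
pose S := [set s | 0 <= s <= t /\ g s <= lo].
have S0 : S 0 by split => //; rewrite lexx.
have Sub : ubound S t by move=> s [/andP[]].
have supS : has_sup S by split; [exists 0 | exists t].
set s0 := sup S.
have s0ge : 0 <= s0 by exact: (ub_le_sup supS.2 S0).
have s0le : s0 <= t by apply: ge_sup => //; exists 0.
have Dc (s : R) : 0 <= s -> `[0, +oo[%classic s by rewrite /= in_itv/= andbT.
(* the supremum is attained, by continuity of g *)
have gs0 : g s0 <= lo.
  rewrite leNgt; apply/negP => ls0.
  have [|eta eta0 near_s0] := within_continuous_dist cg (Dc _ s0ge) (e := g s0 - lo).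
    by rewrite subr_gt0.
  have [s [s0t gs] es] := sup_adherent eta0 supS.
  have ss0 : s <= s0 by apply: ub_le_sup => //; exact: supS.2.
  have /andP[s00 _] := s0t.
  have := near_s0 s (Dc _ s00); rewrite ger0_norm ?subr_ge0// -/s0 in es *.
  have : s0 - s < eta by lra.
  by move=> /[swap]/[apply] /ltr_normlP[]; lra.
have s0t : s0 < t.
  by rewrite lt_neqAle s0le andbT; apply/eqP => s0t; move: gs0; rewrite s0t leNgt glo.
have gt_lo s : s0 < s -> s <= t -> lo < g s.
  move=> s0s st; rewrite ltNge; apply/negP => gs.
  have : s <= s0 by apply: ub_le_sup; [exact: supS.2 | split => //; rewrite st andbT; lra].
  by rewrite leNgt s0s.
have [|eta eta0 near_s0] := within_continuous_dist cg (Dc _ s0ge) (e := hi - lo).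
  by rewrite subr_gt0.
pose t2 := Num.min (s0 + eta / 2) t.
have s0t2 : s0 < t2 by rewrite lt_min s0t andbT ltrDl divr_gt0.
have t2t : t2 <= t by rewrite ge_min lexx orbT.
have t2eta : t2 <= s0 + eta / 2 by rewrite ge_min lexx.
have : g t2 <= g s0.
  have dE (x : R) : x \in `]s0, t2[ -> is_derive x 1 g (g' x).
    by rewrite in_itv/= => /andP[? ?]; apply: dg; lra.
  apply: (@ler0_derive1_le_cc R g s0 t2) => //.
  - by move=> x /dE[].
  - move=> x xt; rewrite derive1E; have [_ ->] := dE x xt.
    move: xt; rewrite in_itv/= => /andP[s0x xt2].
    apply: g'le; first by lra.
    rewrite ltW ?gt_lo//=; last by lra.
    have := near_s0 x (Dc _ _); rewrite distrC ger0_norm; last by lra.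
    move=> H; have {}H : `|g s0 - g x| < hi - lo by apply: H; lra.
    by case/ltr_normlP: H; lra.
  - apply: continuous_subspaceW cg => x /=; rewrite !in_itv/= andbT => /andP[? _].
    exact: le_trans s0ge _.
  - by rewrite in_itv/= lexx ltW.
  - by rewrite in_itv/= lexx ltW.
  - exact: ltW.
by have := gt_lo t2 s0t2 t2t; lra.
Qed.

End Trapping.

Section Flow.
Context {R : realType} {n : nat}.
Variables (A : {linear 'rV[R]_n -> 'rV[R]_n})
  (B : {bilinear 'rV[R]_n -> 'rV[R]_n -> 'rV[R]_n}) (f : 'rV[R]_n).
Variables (r delta : R).
Hypotheses (r_gt0 : 0 < r) (delta_gt0 : 0 < delta).
Hypothesis trap : trapping A B f r delta.
Hypothesis sol_ex : forall v, eball r v -> exists x, solution A B f v x.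

Lemma solution_eball v x : eball r v -> solution A B f v x ->
  forall t, 0 <= t -> eball r (x t).
Proof.
move=> vr [x0 cx dx] t t0; apply/(eball_inner _ (ltW r_gt0)).
have := @barrier R (fun s => inner (x s) (x s))
  (fun s => 2 * inner (x s) (vfield A B f (x s))) (r ^+ 2) ((r + delta) ^+ 2).
apply => //.
- by rewrite ltr_pXn2r// ?nnegrE ?addr_ge0 1?ltW// ltrDl.
- exact: within_continuous_inner cx.
- by move=> s s0; apply: is_derive_inner; exact: dx.
- move=> s s0 /andP[rx xr]; rewrite pmulr_rle0// innerC; apply: trap.
  rewrite /norm2; apply/andP; split.
    by rewrite -[leLHS](ger0_norm (ltW r_gt0)) -sqrtr_sqr ler_wsqrtr.
  have rd0 : 0 <= r + delta by rewrite ltW// addr_gt0.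
  by rewrite -[leRHS](ger0_norm rd0) -sqrtr_sqr ler_wsqrtr.
- by rewrite x0; apply/eball_inner => //; exact: ltW.
Qed.

Lemma flow_solution v : eball r v -> solution A B f v (fun t => flow A B f t v).
Proof. by move=> /sol_ex; exact: xgetPex. Qed.

Lemma flow_eball v t : eball r v -> 0 <= t -> eball r (flow A B f t v).
Proof. by move=> vr; exact: (solution_eball vr (flow_solution vr)). Qed.

Lemma flow0 v : eball r v -> flow A B f 0 v = v.
Proof. by move=> /flow_solution[]. Qed.

(** The differential of the vector field at [x], applied to [d]. *)
Let linearized x d := - A d - B x d - B d x.

(** The vector field is quadratic, so its second-order Taylor expansion is exact. *)
Lemma vfieldB x y : vfield A B f y - vfield A B f x =
  linearized x (y - x) - B (y - x) (y - x).
Proof.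
rewrite /vfield /linearized; move: (y - x) (subrK x y) => d <-.
rewrite !linearD/= !linearDl.
by apply/rowP => i; rewrite !mxE; ring.
Qed.

Lemma linearized_sum x (l : seq (R * 'rV[R]_n)) (F : R * 'rV[R]_n -> 'rV[R]_n) :
  \sum_(p <- l) p.1 *: linearized x (F p) = linearized x (\sum_(p <- l) p.1 *: F p).
Proof.
rewrite /linearized !linear_sum/= linear_sumlz -!sumrN -!big_split/=.
apply: eq_bigr => p _; rewrite !scalerBr scalerN linearZl_LR/=.
by rewrite [A (_ *: _)]linearZ [B x (_ *: _)]linearZ.
Qed.

(** On the ball the quadratic remainder of [vfieldB] is at most linear in the
    difference of the two solutions, so Gronwall applies without forcing. *)
Lemma flow_lipschitz (T : R) : exists2 K : R, 0 < K &
  forall a b, eball r a -> eball r b -> forall t, 0 <= t <= T ->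
  `|flow A B f t b - flow A B f t a| <= K * `|b - a| /\
  `|b - a| <= K * `|flow A B f t b - flow A B f t a|.
Proof.
have [al al0 Ale] := linear_bounded A; have [be be0 Ble] := bilinear_bounded B.
have k0 : 0 <= al + 4 * (be * r) by rewrite addr_ge0// !mulr_ge0// ltW.
have [K K0 gr] := @gronwall R n _ T k0; exists K => // a b ar br.
have [_ ca da] := flow_solution ar; have [_ cb db] := flow_solution br.
move=> t tT.
have [|||s sT|] := gr (fun t => flow A B f t b - flow A B f t a)
   (fun t => vfield A B f (flow A B f t b) - vfield A B f (flow A B f t a)) 0 _ _ _ _ t tT.
- by [].
- have -> : (fun t => flow A B f t b - flow A B f t a) =
      (fun t => 1%R *: (flow A B f t b - flow A B f t a)).
    by apply/funext => s; rewrite scale1r.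
  apply: continuous_subspaceW (within_continuousZB cb ca) => x /=.
  by rewrite !in_itv/= andbT => /andP[].
- move=> s /andP[s0 _]; have := da s s0; have := db s s0 => ? ?.
  exact: is_deriveB.
- have s0 : 0 <= s by case/andP: sT => /ltW.
  have xr := eball_norm (ltW r_gt0) (flow_eball ar s0).
  have yr := eball_norm (ltW r_gt0) (flow_eball br s0).
  rewrite vfieldB addr0 /linearized.
  move: (flow A B f s a) (flow A B f s b) xr yr => x y xr yr.
  set d := y - x.
  have dr : `|d| <= 2 * r by rewrite (le_trans (ler_normB _ _))//; lra.
  rewrite (le_trans (ler_normB _ _))//.
  have := ler_normB (- A d - B x d) (B d x); have := ler_normB (- A d) (B x d).
  rewrite normrN.
  have := Ale d; have := Ble x d; have := Ble d x; have := Ble d d.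
  have d0 := normr_ge0 d.
  have := ler_wpM2l be0 (ler_wpM2r d0 xr); have := ler_wpM2l be0 (ler_wpM2r d0 dr).
  lra.
- by rewrite !flow0// !addr0.
Qed.

(** This estimate replaces the theory of the linearized equation. A linear
    combination [E] of differences to the solution from [a] solves the
    linearized equation along that solution, up to a forcing term which is a sum
    of squares of differences, and [flow_lipschitz] bounds these squares by their
    values at time [0]. Different choices of the coefficients give the existence
    of the derivative of the flow, its linearity and its invertibility. *)
Lemma flow_combination (T : R) : 0 <= T -> exists2 K : R, 0 < K &
  forall a (l : seq (R * 'rV[R]_n)), eball r a -> {in l, forall p, eball r p.2} ->
  let E t := \sum_(p <- l) p.1 *: (flow A B f t p.2 - flow A B f t a) in
  let c := \sum_(p <- l) `|p.1| * `|p.2 - a| ^+ 2 in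
  `|E T| <= K * (`|E 0| + c) /\ `|E 0| <= K * (`|E T| + c).
Proof.
move=> T0; have [L L0 lip] := flow_lipschitz T.
have [al al0 Ale] := linear_bounded A; have [be be0 Ble] := bilinear_bounded B.
have k0 : 0 <= al + 2 * (be * r) by rewrite addr_ge0// !mulr_ge0// ltW.
have [K K0 gr] := @gronwall R n _ T k0.
have beL : 0 <= be * L ^+ 2 by rewrite mulr_ge0// sqr_ge0.
exists (K * (1 + be * L ^+ 2)); first by rewrite mulr_gt0// ltr_wpDr.
move=> a l ar lr E c; pose F s b := flow A B f s b.
have c0 : 0 <= c by apply: sumr_ge0 => p _; rewrite mulr_ge0// sqr_ge0.
have c'0 : 0 <= be * L ^+ 2 * c by exact: mulr_ge0.
have [_ ca da] := flow_solution ar.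
have [||s sT||E1 E2] := gr E (fun s => \sum_(p <- l) p.1 *:
    (vfield A B f (F s p.2) - vfield A B f (F s a))) _ c'0 _ _ _ T _.
- have cE : {within `[0, +oo[, continuous E}.
    apply: within_continuous_sum => p pl; apply: within_continuousZB => //.
    by have [] := flow_solution (lr p pl).
  apply: continuous_subspaceW cE => x /=.
  by rewrite !in_itv/= andbT => /andP[].
- move=> s /andP[s0 _]; apply: is_derive_sum_seq => p pl.
  have [_ _ db] := flow_solution (lr p pl).
  have := da s s0; have := db s s0 => d1 d2.
  exact: (is_deriveZ _ (is_deriveB d1 d2)).
- have s0 : 0 <= s by case/andP: sT => /ltW.
  have sT' : 0 <= s <= T by case/andP: sT => /ltW-> /ltW->.
  have xr := eball_norm (ltW r_gt0) (flow_eball ar s0).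
  under eq_bigr do rewrite vfieldB scalerBr.
  rewrite big_split/= sumrN linearized_sum (le_trans (ler_normB _ _))// lerD//.
    rewrite -/(E s) /linearized.
    have := ler_normB (- A (E s) - B (F s a) (E s)) (B (E s) (F s a)).
    have := ler_normB (- A (E s)) (B (F s a) (E s)).
    have := ler_wpM2l be0 (ler_wpM2r (normr_ge0 (E s)) xr).
    have := Ale (E s); have := Ble (F s a) (E s); have := Ble (E s) (F s a).
    rewrite normrN /F; lra.
  rewrite (le_trans (ler_norm_sum _ _ _))// /c mulr_sumr big_seq [leRHS]big_seq.
  apply: ler_sum => p pl; rewrite normrZ mulrCA ler_wpM2l//.
  rewrite (le_trans (Ble _ _))// -mulrA ler_wpM2l// -expr2 -exprMn.
  rewrite /F ler_pXn2r ?nnegrE ?mulr_ge0// ?(ltW L0)//.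
  by apply: (proj1 (lip _ _ _ _ _ _)) => //; exact: lr.
- by rewrite T0 lexx.
have widen x : 0 <= x -> K * (x + be * L ^+ 2 * c) <= K * (1 + be * L ^+ 2) * (x + c).
  move=> x0; rewrite -[leRHS]mulrA ler_wpM2l ?(ltW K0)//.
  by have := mulr_ge0 beL x0; lra.
by split; [exact: le_trans E1 (widen _ _) | exact: le_trans E2 (widen _ _)].
Qed.

End Flow.

(** * Differential of the inverse of a map with approximately linear increments *)

Section Limits.
Context {R : realType}.

Lemma le_of_le_addM (x y q : R) :
  (forall s, 0 < s <= 1 -> x <= y + s * q) -> x <= y.
Proof.
move=> xy; apply/ler_addgt0Pr => e e0.
have q0 : 0 < `|q| + 1 by rewrite ltr_wpDl.
have [] := leP 1 (e / (`|q| + 1)).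
  rewrite ler_pdivlMr// mul1r => qe.
  have := xy 1; rewrite ltr01 lexx => /(_ isT).
  by have := ler_norm q; lra.
move=> /ltW e1; have s0 : 0 < e / (`|q| + 1) by rewrite divr_gt0.
have := xy _ (introT andP (conj s0 e1)).
move/le_trans; apply; rewrite lerD2l mulrAC ler_pdivrMr// ler_pM2l//.
by have := ler_norm q; lra.
Qed.

(** A quantitative Cauchy criterion as [s] tends to [0], with the rate of
    convergence; the limit is the supremum of the lower bounds [d s - k s]. *)
Lemma approx_limit (d : R -> R) (k : R) :
  (forall s t, 0 < s <= 1 -> 0 < t <= 1 -> `|d s - d t| <= k * (s + t)) ->
  exists w, forall s, 0 < s <= 1 -> `|d s - w| <= k * s.
Proof.
move=> dk; pose S := [set d s - k * s | s in [set s : R | 0 < s <= 1]].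
have lt01 : 0 < (1 : R) <= 1 by rewrite ltr01 lexx.
have S0 : S !=set0 by exists (d 1 - k * 1), 1.
have Sub t : 0 < t <= 1 -> ubound S (d t + k * t).
  by move=> t1 _ [s s1 <-]; have /ler_normlP[] := dk s t s1 t1; lra.
exists (sup S) => s s1; rewrite ler_distlC; apply/andP; split.
  by apply: ub_le_sup; [exists (d 1 + k * 1); exact: Sub | exists s].
by apply: ge_sup => //; exact: Sub.
Qed.

End Limits.

(** [psi] stands for the flow at a fixed time and [S] for the ball. The rows of
    [M] are a basis of directions along which [S] contains segments from [a];
    such a basis exists even when [a] is a boundary point, and it is the reason
    why the differential of the inverse relative to [psi @` S] is unique. *)
Section InverseDifferential.
Context {R : realType} {n : nat}.
Variables (S : set 'rV[R]_n) (psi : 'rV[R]_n -> 'rV[R]_n) (a : 'rV[R]_n).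
Variables (M : 'M[R]_n) (K L : R).
Hypotheses (K_gt0 : 0 < K) (L_gt0 : 0 < L).
Hypothesis M_unit : M \in unitmx.
Hypothesis S_a : S a.
Hypothesis segments : forall i s, 0 <= s <= 1 -> S (a + s *: row i M).
Hypothesis lipschitz : forall b, S b ->
  `|psi b - psi a| <= L * `|b - a| /\ `|b - a| <= L * `|psi b - psi a|.
Hypothesis combination : forall (l : seq (R * 'rV[R]_n)),
  {in l, forall p, S p.2} ->
  let E0 := \sum_(p <- l) p.1 *: (p.2 - a) in
  let E1 := \sum_(p <- l) p.1 *: (psi p.2 - psi a) in
  let c := \sum_(p <- l) `|p.1| * `|p.2 - a| ^+ 2 in
  `|E1| <= K * (`|E0| + c) /\ `|E0| <= K * (`|E1| + c).

Let p i s := a + s *: row i M.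

Let pB i s : p i s - a = s *: row i M.
Proof. by rewrite /p addrC addKr. Qed.

(** Row [i] of [W] is the one-sided derivative of [psi] at [a] in the direction
    [row i M]. The difference quotients with steps [s] and [t] form a combination
    with [E0 = 0], hence they differ by [O(s + t)]. *)
Lemma directional_derivatives : exists W : 'M[R]_n, exists2 k, 0 <= k &
  forall i s, 0 < s <= 1 ->
    `|psi (p i s) - psi a - s *: row i W| <= k * s ^+ 2.
Proof.
pose D i s := s^-1 *: (psi (p i s) - psi a).
pose k := K * \sum_i `|row i M| ^+ 2.
have k0 : 0 <= k by rewrite mulr_ge0 ?(ltW K_gt0)// sumr_ge0// => i _; rewrite sqr_ge0.
have Dcauchy i s t : 0 < s <= 1 -> 0 < t <= 1 -> `|D i s - D i t| <= k * (s + t).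
  move=> /andP[s0 s1] /andP[t0 t1].
  have [|] := @combination [:: (s^-1, p i s); (- t^-1, p i t)].
    move=> q; rewrite !inE => /orP[] /eqP -> /=; apply: segments;
      by rewrite ltW.
  rewrite !big_cons !big_nil/= !addr0 !pB scaleNr scalerA mulVf ?gt_eqF//.
  rewrite scaleNr scalerA mulVf ?gt_eqF// scale1r subrr normr0 add0r.
  rewrite normrN !normrZ !gtr0_norm ?invr_gt0// !exprMn => DD _.
  rewrite (le_trans DD)// /k -mulrA ler_wpM2l ?(ltW K_gt0)//.
  rewrite !expr2 !mulrA !mulVf ?gt_eqF// !mul1r -!mulrA -mulrDl mulrC -expr2.
  rewrite ler_wpM2r ?addr_ge0 ?(ltW s0) ?(ltW t0)//.
  by rewrite (bigD1 i)//= lerDl sumr_ge0// => j _; rewrite sqr_ge0.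
have Dlim i j : exists w, forall s, 0 < s <= 1 -> `|D i s 0 j - w| <= k * s.
  apply: approx_limit => s t s1 t1; rewrite (le_trans _ (Dcauchy i s t s1 t1))//.
  by have := coord_le_norm (D i s - D i t) j; rewrite !mxE.
have [w wP] := choice (fun ij : 'I_n * 'I_n => Dlim ij.1 ij.2).
exists (\matrix_(i, j) w (i, j)), k => // i s s1.
have s0 : 0 < s by case/andP: s1.
have -> : psi (p i s) - psi a - s *: row i (\matrix_(i, j) w (i, j)) =
    s *: (D i s - row i (\matrix_(i, j) w (i, j))).
  by rewrite scalerBr scalerA divff ?gt_eqF// scale1r.
rewrite normrZ gtr0_norm// mulrC expr2 mulrA ler_wpM2r ?(ltW s0)//.
apply: norm_le_coord => [|j]; first by rewrite mulr_ge0// ltW.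
by have := wP (i, j) s s1; rewrite !mxE.
Qed.

Section Linearization.
Variables (W : 'M[R]_n) (k : R).
Hypothesis W_deriv : forall i s, 0 < s <= 1 ->
  `|psi (p i s) - psi a - s *: row i W| <= k * s ^+ 2.

Lemma sum_approx (c : 'rV[R]_n) : exists q, forall s, 0 < s <= 1 ->
  `|c *m W - \sum_i (c 0 i / s) *: (psi (p i s) - psi a)| <= s * q.
Proof.
exists (\sum_i `|c 0 i| * k) => s s1; have s0 : 0 < s by case/andP: s1.
rewrite mulmx_sum_row -sumrB (le_trans (ler_norm_sum _ _ _))//.
rewrite mulr_sumr ler_sum// => i _.
have -> : c 0 i *: row i W - (c 0 i / s) *: (psi (p i s) - psi a) =
   (- (c 0 i / s)) *: (psi (p i s) - psi a - s *: row i W).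
  by rewrite [in RHS]scalerBr scalerA mulNr divfK ?gt_eqF// !scaleNr opprK addrC.
rewrite normrZ normrN normrM normfV (gtr0_norm s0).
rewrite (le_trans (ler_wpM2l _ (W_deriv i s1)))// ?divr_ge0 ?(ltW s0)//.
by rewrite expr2 -mulrA (mulrA k) (mulrCA s^-1) mulVf ?gt_eqF// mulr1; lra.
Qed.

Let cst (c : 'rV[R]_n) (s : R) := \sum_i `|c 0 i / s| * `|p i s - a| ^+ 2.

Let cstE (c : 'rV[R]_n) (s : R) : 0 < s -> cst c s = s * \sum_i `|c 0 i| * `|row i M| ^+ 2.
Proof.
move=> s0; rewrite mulr_sumr; apply: eq_bigr => i _.
rewrite pB normrM [`|_ *: row _ _|]normrZ normfV (gtr0_norm s0) exprMn.
by field; rewrite gt_eqF.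
Qed.

Let sumM (c : 'rV[R]_n) (s : R) : 0 < s -> \sum_i (c 0 i / s) *: (p i s - a) = c *m M.
Proof.
move=> s0; rewrite mulmx_sum_row; apply: eq_bigr => i _.
by rewrite pB scalerA divfK ?gt_eqF.
Qed.

(** The backward bound for the combination of difference quotients with
    coefficients [c], in the limit of small steps. *)
Lemma linearization_inj (c : 'rV[R]_n) : `|c *m M| <= K * `|c *m W|.
Proof.
have [q Hq] := sum_approx c.
apply: (@le_of_le_addM _ _ _ (K * (q + \sum_i `|c 0 i| * `|row i M| ^+ 2))).
move=> s s1; have s0 : 0 < s by case/andP: s1.
have [|_] := @combination [seq (c 0 i / s, p i s) | i <- index_enum 'I_n].
  move=> _ /mapP[i _ ->] /=; apply: segments; by case/andP: s1 => /ltW ->.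
rewrite !big_map/= sumM// -/(cst c s) cstE// => cM.
have := Hq s s1; set E := \sum_i _ in cM * => cWE.
have EcW : `|E| <= `|c *m W| + s * q.
  rewrite -(subKr (c *m W) E) (le_trans (ler_normB _ _))// lerD//.
rewrite (le_trans cM)// [leRHS](_ : _ = K * (`|c *m W| + s * q +
    s * \sum_i `|c 0 i| * `|row i M| ^+ 2)); last by ring.
by rewrite ler_wpM2l ?(ltW K_gt0)// lerD2r.
Qed.

(** [b - a] has coordinates [c := (b - a) *m invmx M] in the basis [M]. The
    combination that subtracts from [b] the points at small steps along the basis
    with these coordinates has [E0 = 0]; this proves linearity and
    differentiability at once. *)
Lemma linearization_approx b : S b ->
  `|psi b - psi a - (b - a) *m invmx M *m W| <= K * `|b - a| ^+ 2.
Proof.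
move=> Sb; set c := (b - a) *m invmx M.
have [q Hq] := sum_approx c.
apply: (@le_of_le_addM _ _ _ (K * (\sum_i `|c 0 i| * `|row i M| ^+ 2) + q)).
move=> s s1; have s0 : 0 < s by case/andP: s1.
have [|+ _] := @combination ((1, b) ::
    [seq (- (c 0 i / s), p i s) | i <- index_enum 'I_n]).
  move=> x; rewrite inE => /orP[/eqP -> //|/mapP[i _ ->]] /=.
  by apply: segments; case/andP: s1 => /ltW ->.
rewrite !big_cons !big_map/= !scale1r normr1 mul1r.
under eq_bigr do rewrite scaleNr.
under [in leRHS]eq_bigr do rewrite scaleNr.
under [in X in K * (_ + (_ + X))]eq_bigr do rewrite normrN.
rewrite -/(cst c s) cstE// !sumrN sumM// /c mulmxKV// -/c subrr normr0 add0r.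
have := Hq s s1; set E := \sum_i _ *: _ => cWE EK.
have -> : psi b - psi a - c *m W = (psi b - psi a - E) - (c *m W - E).
  by rewrite opprB addrA subrK.
rewrite (le_trans (ler_normB _ _))//; lra.
Qed.

Lemma linearization_unit : W \in unitmx.
Proof.
rewrite -row_free_unit -kermx_eq0; apply/eqP/row_matrixP => i; rewrite row0.
have : row i (kermx W) *m W = 0 by rewrite -row_mul mulmx_ker row0.
move: (row i _) => c cW0.
have := linearization_inj c; rewrite cW0 normr0 mulr0 normr_le0 => /eqP cM.
by rewrite -(mulmxK M_unit c) cM mul0mx.
Qed.

End Linearization.

Lemma inverse_expansion : exists2 G : 'M[R]_n, G \in unitmx &
  exists2 q, 0 < q & forall b, S b ->
    `|b - a - (psi b - psi a) *m G| <= q * `|psi b - psi a| ^+ 2.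
Proof.
have [W [k k0 Wk]] := directional_derivatives.
have W_unit := linearization_unit Wk.
exists (invmx W *m M); first by rewrite unitmx_mul unitmx_inv W_unit.
have [g g0 gP] := linear_bounded (mulmxr (invmx W *m M) : {linear 'rV[R]_n -> 'rV[R]_n}).
have q0 : 0 < (g + 1) * (K * L ^+ 2).
  by rewrite !mulr_gt0// ?exprn_gt0// ltr_wpDl.
exists ((g + 1) * (K * L ^+ 2)) => // b Sb.
have -> : b - a - (psi b - psi a) *m (invmx W *m M) =
  - ((psi b - psi a - (b - a) *m invmx M *m W) *m (invmx W *m M)).
  move: (psi b - psi a) (b - a) => D d.
  rewrite mulmxBl opprB [X in _ = X - _](_ : _ = d)//.
  by rewrite !mulmxA mulmxK// mulmxKV.
rewrite normrN (le_trans (gP _))// -mulrA.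
apply: ler_pM => //; first by rewrite lerDl.
rewrite (le_trans (linearization_approx Wk Sb))// -mulrA ler_wpM2l ?(ltW K_gt0)//.
rewrite -exprMn ler_pXn2r ?nnegrE ?mulr_ge0 ?(ltW L_gt0)//.
by have [] := lipschitz Sb.
Qed.

(** Along the basis, the expansion of the inverse gives [row i M = row i W *m N],
    so that [M = W *m N] and [N] is invertible because [M] is. *)
Lemma inverse_differential_unit (N : 'M[R]_n) :
  (forall e, 0 < e -> exists2 eta, 0 < eta & forall b, S b ->
    `|psi b - psi a| < eta ->
    `|b - a - (psi b - psi a) *m N| <= e * `|psi b - psi a|) ->
  N \in unitmx.
Proof.
move=> HN; have [W [k k0 Wk]] := directional_derivatives.
suff MWN : M = W *m N by move: M_unit; rewrite MWN unitmx_mul => /andP[].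
have [nu nu0 nuP] := linear_bounded (mulmxr N : {linear 'rV[R]_n -> 'rV[R]_n}).
apply/row_matrixP => i; rewrite row_mul; apply/eqP; rewrite -subr_eq0 -normr_le0.
set m := row i M; set w := row i W.
apply: (@le_of_le_addM _ _ _ (L * `|m| + nu * k)) => e /andP[e0 _].
have [eta eta0 Heta] := HN e e0.
have Lm : 0 < L * `|m| + 1 by rewrite ltr_wpDl// mulr_ge0// ltW.
(* s <= 1 keeps the point in S, s <= e absorbs the error of W, and the last bound
   puts the image within eta of psi a *)
pose s := Num.min (Num.min 1 e) (eta / (L * `|m| + 1)).
have s0 : 0 < s by rewrite !lt_min ltr01 e0 divr_gt0.
have s1 : s <= 1 by rewrite !ge_min lexx.
have se : s <= e by rewrite !ge_min lexx orbT.
have seta : s * (L * `|m| + 1) <= eta by rewrite -ler_pdivlMr// !ge_min lexx orbT.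
have Sp : S (p i s) by apply: segments; rewrite ltW.
have := Wk i s (introT andP (conj s0 s1)); have := (lipschitz Sp).1.
rewrite pB normrZ (gtr0_norm s0) -/m -/w => lip Ws.
have := Heta _ Sp; rewrite pB -/m.
move: (psi (p i s) - psi a) lip Ws => D lip Ws.
move=> /(_ _)/wrap[|DN]; first by rewrite (le_lt_trans lip)//; lra.
have -> : m - w *m N = s^-1 *: ((s *: m - D *m N) + (D - s *: w) *m N).
  rewrite mulmxBl addrA subrK -scalemxAl -scalerBr scalerA mulVf ?gt_eqF//.
  by rewrite scale1r.
rewrite normrZ gtr0_norm ?invr_gt0// ler_pdivrMl// add0r.
rewrite (le_trans (ler_normD _ _))//.
have DwN := nuP (D - s *: w).
have := le_trans DN (ler_wpM2l (ltW e0) lip).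
have := le_trans DwN (ler_wpM2l nu0 Ws).
have : s * (s * (nu * k)) <= s * (e * (nu * k)).
  by rewrite ler_wpM2l ?(ltW s0)// ler_wpM2r// mulr_ge0.
rewrite /=; lra.
Qed.

Lemma rV_linear_continuous (A : {linear 'rV[R]_n -> 'rV[R]_n}) : continuous A.
Proof.
have [g g0 gP] := linear_bounded A.
apply/linear_bounded_continuous/linear_boundedP.
near=> r => v; rewrite (le_trans (gP v))// ler_wpM2r//.
Unshelve. all: by end_near. Qed.

(** The operator ['d] picks some continuous linear map satisfying the expansion,
    if there is one: [inverse_expansion] provides one, and whichever is picked is
    invertible by [inverse_differential_unit]. *)
Lemma det_inverse_differential (g : 'rV[R]_n -> 'rV[R]_n) :
  (forall b, S b -> g (psi b) = b) ->
  \det (lin1_mx ('d g (within (psi @` S) (nbhs (psi a))))) != 0.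
Proof.
move=> gK; have [G G_unit [q q0 Gq]] := inverse_expansion.
set F := within _ _.
have FF : ProperFilter F.
  apply: within_nbhs_proper; apply: subset_closure; by exists a.
have limE : lim F = psi a.
  apply: (@cvg_lim _ _ _ F _ id) => //; exact: cvg_within.
rewrite -unitfE -[_ \is a _]/(lin1_mx _ \in unitmx).
apply: inverse_differential_unit.
set df := diff _ _.
have [_ dfP] : continuous df /\ forall x,
    g x = g (lim F) + df (x - lim F) +o_(x \near F) (x - lim F).
  apply: (@xgetPex _ point (fun df : {linear 'rV[R]_n -> 'rV[R]_n} => continuous df /\
    forall x, g x = g (lim F) + df (x - lim F) +o_(x \near F) (x - lim F))).
  exists (mulmxr G : {linear 'rV[R]_n -> 'rV[R]_n}); split; first exact: rV_linear_continuous.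
  have H : g = (fun x => g (lim F) + (x - lim F) *m G) +o_F (fun x => x - lim F).
    apply/eqaddoP => e e0; rewrite near_withinE.
    apply/nbhs_ballP; exists (e / q); first by rewrite /= divr_gt0.
    move=> x; rewrite -ball_normE/= distrC => xq [b Sb bx].
    rewrite -bx in xq *; rewrite fctE/= limE !gK// opprD addrA.
    rewrite (le_trans (Gq b Sb))// expr2 mulrA ler_wpM2r//.
    by rewrite mulrC -ler_pdivlMr// ltW.
  apply: eqaddoEx => x; rewrite {1}H; reflexivity.
move=> e e0.
have {}dfP : g = (fun x => g (lim F) + df (x - lim F)) +o_F (fun x => x - lim F).
  by apply/eqaddoE/funext => x; rewrite {1}dfP; reflexivity.
move/eqaddoP : dfP => /(_ e e0); rewrite near_withinE => /nbhs_ballP[eta /= eta0 H].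
exists eta => // b Sb bq.
have := H (psi b); rewrite -ball_normE/= distrC => /(_ bq).
rewrite fctE/= limE !gK// mul_rV_lin1 opprD addrA; apply.
by exists b.
Qed.

End InverseDifferential.

(** * The inverse flow *)

(** The segments go from [a] to the points [sg i * r] on the coordinate axes,
    with the sign opposite to that of [a 0 i]. This choice makes the directions
    independent: if [c *m M = 0] then [r c_j = - (\sum_k c_k) |a_j|], and summing
    over [j] gives [(\sum_k c_k) (r + \sum_j |a_j|) = 0]. *)
Lemma eball_segments {R : realType} n (r : R) (a : 'rV[R]_n) : 0 < r ->
  eball r a -> exists2 M : 'M[R]_n, M \in unitmx &
  forall i s, 0 <= s <= 1 -> eball r (a + s *: row i M).
Proof.
move=> r0 ar; pose sg i : R := if 0 <= a 0 i then -1 else 1.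
have sga i : sg i * a 0 i = - `|a 0 i|.
  rewrite /sg; case: ifPn => ai; first by rewrite ger0_norm// mulN1r.
  by rewrite mul1r ltr0_norm ?opprK// ltNge.
have sg2 i : sg i * sg i = 1 by rewrite /sg; case: ifP => _; rewrite ?mulr1// mulrNN mulr1.
exists (\matrix_(i, j) ((i == j)%:R * (sg i * r) - a 0 j)); last first.
  move=> i s s01; rewrite (_ : row i _ = (sg i * r) *: delta_mx 0 i - a); last first.
    by apply/rowP => j; rewrite !mxE eqxx/= eq_sym mulrC.
  apply: eball_convex => //; first exact: ltW.
  apply/eball_inner; first exact: ltW.
  rewrite /inner (bigD1 i)//= big1 ?addr0 => [|j ji]; rewrite !mxE eqxx/=.
    by rewrite eqxx mulr1 mulrACA sg2 mul1r expr2.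
  by rewrite (negbTE ji) mulr0 mul0r.
rewrite -row_free_unit -kermx_eq0; apply/eqP/row_matrixP => i; rewrite row0.
set M := \matrix_(_, _) _.
have : row i (kermx M) *m M = 0 by rewrite -row_mul mulmx_ker row0.
move: (row i _) => c /rowP cM.
have {}cM j : c 0 j * r = - (\sum_k c 0 k) * `|a 0 j|.
  have := cM j; rewrite !mxE.
  under eq_bigr do rewrite mxE mulrBr.
  rewrite sumrB -mulr_suml (bigD1 j)//= big1 => [|k kj]; last first.
    by rewrite (negbTE kj) mul0r mulr0.
  rewrite eqxx mul1r addr0 => /eqP; rewrite subr_eq0 => /eqP cs.
  rewrite mulNr -mulrN -sga mulrCA -cs mulrCA.
  by rewrite (mulrA (sg j)) sg2 mul1r.
have S0 : \sum_k c 0 k = 0.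
  have : (\sum_k c 0 k) * (r + \sum_k `|a 0 k|) = 0.
    rewrite mulrDr mulr_suml (eq_bigr _ (fun j _ => cM j)) -mulr_sumr.
    by rewrite mulNr addNr.
  move/eqP; rewrite mulf_eq0 => /orP[/eqP //|].
  by rewrite gt_eqF// ltr_wpDr// sumr_ge0.
apply/rowP => j; rewrite mxE; have /eqP := cM j.
by rewrite S0 oppr0 mul0r mulf_eq0 (gt_eqF r0) orbF => /eqP.
Qed.

Section FlowInverse.
Context {R : realType} {n : nat}.
Variables (A : {linear 'rV[R]_n -> 'rV[R]_n})
  (B : {bilinear 'rV[R]_n -> 'rV[R]_n -> 'rV[R]_n}) (f : 'rV[R]_n).
Variables (r delta : R).
Hypotheses (r_gt0 : 0 < r) (delta_gt0 : 0 < delta).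
Hypothesis trap : trapping A B f r delta.
Hypothesis sol_ex : forall v, eball r v -> exists x, solution A B f v x.

Lemma flow_inj t a b : 0 <= t -> eball r a -> eball r b ->
  flow A B f t a = flow A B f t b -> a = b.
Proof.
move=> t0 ar br ab; have [K K0 lip] := flow_lipschitz r_gt0 delta_gt0 trap sol_ex t.
have [|_] := lip a b ar br t; first by rewrite t0 lexx.
rewrite ab subrr normr0 mulr0 normr_le0 subr_eq0 => /eqP.
by [].
Qed.

Lemma flow_invK t b : 0 <= t -> eball r b -> flow_inv A B f r t (flow A B f t b) = b.
Proof.
move=> t0 br; rewrite /flow_inv pinvKV ?inE// => x y; rewrite !inE => xr yr.
exact: flow_inj.
Qed.

Lemma det_flow_inv_jacobian t a : 0 <= t -> eball r a ->
  \det (flow_inv_jacobian A B f r t (flow A B f t a)) != 0.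
Proof.
move=> t0 ar.
have [K K0 comb] := flow_combination r_gt0 delta_gt0 trap sol_ex t0.
have [L L0 lip] := flow_lipschitz r_gt0 delta_gt0 trap sol_ex t.
have [M Mu Mseg] := eball_segments r_gt0 ar.
apply: (det_inverse_differential K0 L0 Mu ar Mseg).
- by move=> b br; apply: lip => //; rewrite t0 lexx.
- move=> l lr /=; have /= := comb a l ar lr.
  suff -> : \sum_(p <- l) p.1 *: (flow A B f 0 p.2 - flow A B f 0 a) =
            \sum_(p <- l) p.1 *: (p.2 - a) by [].
  apply: eq_big_seq => p pl; rewrite !(flow0 sol_ex)//; exact: lr.
- by move=> b br; exact: flow_invK.
Qed.

End FlowInverse.

(** * Uniform noise *)

Section Iterated.
Context {R : realType}.

(** The factor [k] collects the coordinates that are already integrated out, so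
    that the induction goes through. *)
Lemma integral_rV_prod n (k : R) (F : 'I_n -> R -> R) (c : 'I_n -> R) :
  0 <= k -> (forall j x, 0 <= F j x) ->
  (forall j, measurable_fun [set: R] (F j)) ->
  (forall j, \int[lebesgue_measure]_(x in [set: R]) (F j x)%:E = (c j)%:E)%E ->
  integral_rV (fun v : 'rV[R]_n => (k * \prod_j F j (v 0 j))%:E) =
  (k * \prod_j c j)%:E.
Proof.
move=> + F0 mF Fc.
elim: n k F c F0 mF Fc => [|n IH] k F c F0 mF Fc k0; first by rewrite /= !big_ord0.
have c0 j : 0 <= c j.
  by rewrite -lee_fin -Fc; apply: integral_ge0 => x _; rewrite lee_fin.
rewrite /=; under eq_integral => x _.
  rewrite (_ : (fun v => _) = (fun v : 'rV[R]_n =>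
      (k * F ord0 x * \prod_j F (lift ord0 j) (v 0 j))%:E)); last first.
    apply/funext => v; rewrite big_ord_recl mulrA.
    have -> : row_mx (x%:M : 'rV[R]_1) v 0 ord0 = x.
      have -> : ord0 = lshift n (ord0 : 'I_1) by apply/val_inj.
      by rewrite row_mxEl mxE eqxx.
    congr (_ * _)%:E; apply: eq_bigr => j _.
    have -> : row_mx (x%:M : 'rV[R]_1) v 0 (lift ord0 j) = v 0 j.
      have ej : lift ord0 j = rshift 1 j :> 'I_(1 + n) by exact: val_inj.
      by rewrite -(row_mxEr (x%:M : 'rV[R]_1) v) -ej.
    by [].
  rewrite (IH _ (fun j => F (lift ord0 j)) (fun j => c (lift ord0 j)))//; last by rewrite mulr_ge0.
  rewrite mulrAC EFinM.
  over.
rewrite ge0_integralZl_EFin//=.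
- by rewrite Fc big_ord_recl -EFinM; congr _%:E; ring.
- by move=> x _; rewrite lee_fin.
- by apply/measurable_EFinP; exact: mF.
- by apply: mulr_ge0 => //; apply: prodr_ge0.
Qed.

Lemma weierstrass_product (I : eqType) (s : seq I) (x : I -> R) :
  {in s, forall i, 0 <= x i <= 1} ->
  1 - \sum_(i <- s) x i <= \prod_(i <- s) (1 - x i).
Proof.
move=> x01; have [//] : 1 - \sum_(i <- s) x i <= \prod_(i <- s) (1 - x i) /\
  0 <= \prod_(i <- s) (1 - x i) <= 1.
elim: s x01 => [|i s IH] x01; first by rewrite !big_nil subr0 lexx ler01.
have /andP[xi0 xi1] := x01 i (mem_head _ _).
have [|Hs /andP[p0 p1]] := IH.
  by move=> j js; apply: x01; rewrite in_cons js orbT.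
rewrite !big_cons; have s0 : 0 <= \sum_(j <- s) x j.
  rewrite big_seq; apply: sumr_ge0 => j js.
  by have /andP[] : 0 <= x j <= 1 by apply: x01; rewrite in_cons js orbT.
split; first by nra.
by apply/andP; split; nra.
Qed.

Lemma prode_ge_prod (I : eqType) (s : seq I) (y : I -> R) (p : I -> \bar R) :
  {in s, forall i, 0 <= y i} -> {in s, forall i, (y i)%:E <= p i}%E ->
  ((\prod_(i <- s) y i)%:E <= \prod_(i <- s) p i)%E.
Proof.
elim: s => [|i s IH] y0 yp; first by rewrite !big_nil.
have tl j : j \in s -> j \in i :: s by rewrite in_cons => ->; rewrite orbT.
rewrite !big_cons EFinM lee_pmul ?lee_fin//.
- by apply: y0; exact: mem_head.
- by rewrite big_seq prodr_ge0// => j js; apply: y0; exact: tl.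
- by apply: yp; exact: mem_head.
- by apply: IH => j js; [apply: y0|apply: yp]; exact: tl.
Qed.

Lemma overlap_itv (eps a : R) : [set y | `|y| <= eps /\ `|y + a| <= eps] =
  `[Num.max (- eps) (- eps - a), Num.min eps (eps - a)]%classic.
Proof.
apply/seteqP; split => x /=; rewrite in_itv/= ge_max le_min.
  by move=> [/ler_normlP[? ?] /ler_normlP[? ?]]; apply/andP; split; apply/andP; split; lra.
by move=> /andP[/andP[? ?] /andP[? ?]]; split; apply/ler_normlP; split; lra.
Qed.

Lemma integral_uniform_shift (eps a : R) : 0 < eps -> `|a| <= 2 * eps ->
  (\int[lebesgue_measure]_(x in [set: R])
     (uniform_pdf (- eps) eps x *
       \1_[set y | `|y| <= eps /\ `|y + a| <= eps] x)%:E =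
   (1 - `|a| / (2 * eps))%:E)%E.
Proof.
move=> e0 ae.
pose I := `[Num.max (- eps) (- eps - a), Num.min eps (eps - a)]%classic.
have mI : measurable I by exact: measurable_itv.
rewrite overlap_itv -/I.
under eq_integral => x _.
  rewrite (_ : _ * _ = (2 * eps)^-1 * \1_I x); last first.
    rewrite indicE; case: (boolP (x \in I)) => xI; last by rewrite !mulr0.
    move: xI; rewrite inE /I/= in_itv/= ge_max le_min => /andP[/andP[? _] /andP[? _]].
    rewrite /uniform_pdf ifT; last by apply/andP.
    by congr (_^-1 * _); ring.
  rewrite EFinM.
  over.
rewrite ge0_integralZl_EFin//=; last 2 first.
- by apply/measurable_EFinP; exact: measurable_indic.
- by rewrite invr_ge0 mulr_ge0// ltW.
rewrite integral_indic// setIT /I [X in (_ * X)%E]lebesgue_measure_itv/= lte_fin.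
have -> : Num.min eps (eps - a) = eps - Num.max 0 a.
  by have [?|?] := leP 0 a; [rewrite min_r | rewrite min_l]; lra.
have -> : Num.max (- eps) (- eps - a) = - eps - Num.min 0 a.
  by have [?|?] := leP 0 a; [rewrite max_l | rewrite max_r]; lra.
have mM : Num.max 0 a - Num.min 0 a = `|a|.
  have [?|?] := leP 0 a; first by rewrite subr0 ger0_norm.
  by rewrite sub0r ltr0_norm.
have W : eps - Num.max 0 a - (- eps - Num.min 0 a) = 2 * eps - `|a|.
  by rewrite -mM; ring.
have Wpos : (- eps - Num.min 0 a < eps - Num.max 0 a) = (0 < 2 * eps - `|a|).
  by rewrite -subr_gt0 W.
rewrite Wpos; case: ifPn => [_|].
  rewrite -EFinB -EFinM W mulrBr mulVf ?mulf_neq0 ?gt_eqF//.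
  by rewrite mulrC.
rewrite -leNgt mule0 => ?.
have -> : `|a| = 2 * eps by apply/eqP; rewrite eq_le ae/=; lra.
by rewrite divff ?subrr// mulf_neq0 ?gt_eqF.
Qed.

End Iterated.

Section Noise.
Context {R : realType} {m : nat}.

(** For these values of the noise at one observation time, an initial point whose
    predicted observation differs by [a] from the true one is as compatible with
    the observation as the true initial point. *)
Definition overlap (eps : R) (a : 'rV[R]_m) : set (@borelV R m) :=
  [set z : 'rV[R]_m | forall j, `|z 0 j| <= eps /\ `|z 0 j + a 0 j| <= eps].

Lemma measurable_overlap eps a : measurable (overlap eps a).
Proof.
suff oC : open (~` overlap eps a : set 'rV[R]_m).
  by rewrite -[X in measurable X]setCK; apply: measurableC; exact: sub_sigma_algebra.
apply: closed_openC.
have -> : overlap eps a = \bigcap_(j in [set: 'I_m])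
    ((fun z : 'rV[R]_m => z 0 j) @^-1` [set y | `|y| <= eps /\ `|y + a 0 j| <= eps]).
  by apply/seteqP; split => z /= H j; [move=> _; exact: H | exact: H].
apply: closed_bigI => j _; rewrite overlap_itv; apply: preimage_closed.
  by move=> z _; exact: (@coord_continuous R 1 m 0 j z).
exact: interval_closed.
Qed.

Lemma uniform_overlap (eps : R) (a : 'rV[R]_m) : 0 < eps -> (forall j, `|a 0 j| <= 2 * eps) ->
  integral_rV (fun z => (uniform_density eps z * \1_(overlap eps a) z)%:E) =
  (\prod_j (1 - `|a 0 j| / (2 * eps)))%:E.
Proof.
move=> e0 ae.
pose J j := [set y : R | `|y| <= eps /\ `|y + a 0 j| <= eps].
have -> : (fun z => (uniform_density eps z * \1_(overlap eps a) z)%:E) =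
  (fun z => (1 * \prod_j (uniform_pdf (- eps) eps (z 0 j) * \1_(J j) (z 0 j)))%:E).
  apply/funext => z; rewrite mul1r big_split/=; congr (_ * _)%:E.
  rewrite indicE; case: (boolP (z \in _)); rewrite ?inE ?notin_setE => zE.
    by rewrite big1// => j _; rewrite indicE mem_set//; exact: zE.
  have /existsNP[j zj] := zE.
  by rewrite (bigD1 j)//= indicE memNset// mul0r.
have -> := @integral_rV_prod R m 1
   (fun j x => uniform_pdf (- eps) eps x * \1_(J j) x)
   (fun j => 1 - `|a 0 j| / (2 * eps)).
- by rewrite mul1r.
- by [].
- by move=> j x; rewrite mulr_ge0// ?indicE// uniform_pdf_ge0//; lra.
- move=> j; apply: measurable_funM; first exact: measurable_uniform_pdf.
  by apply: measurable_indic; rewrite /J overlap_itv; exact: measurable_itv.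
- by move=> j; exact: integral_uniform_shift.
Qed.

(** Each coordinate contributes a factor [1 - |a_ij| / (2 eps)] to the probability,
    and a product of factors [1 - x] is at least [1 - \sum x], here at least
    [1 - eps / (2 eps)]. *)
Lemma prob_overlap d (T : measurableType d) (P : probability T R)
   (Z : nat -> {RV P >-> borelV m}) (eps : R) (a : nat -> 'rV[R]_m) (k : nat) :
  0 < eps -> mutually_independent P Z ->
  (forall i, has_density P (Z i) (uniform_density eps)) ->
  \sum_(i < k) norm1 (a i) <= eps ->
  ((2^-1)%:E <= P (\bigcap_(i in [set` iota 0 k]) Z i @^-1` overlap eps (a i)))%E.
Proof.
move=> e0 Zind Zunif ae; pose x i := norm1 (a i) / (2 * eps).
have e2 : 0 < 2 * eps by rewrite mulr_gt0.
have norm1_ge0 i : 0 <= norm1 (a i) by apply: sumr_ge0.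
have prob_i i : (i < k)%N -> ((1 - x i)%:E <= P (Z i @^-1` overlap eps (a i)))%E.
  move=> ik; have aie : norm1 (a i) <= eps.
    rewrite (le_trans _ ae)// (bigD1 (Ordinal ik))//= lerDl.
    by apply: sumr_ge0 => l _; apply: sumr_ge0.
  have aije j : `|a i 0 j| <= eps.
    by rewrite (le_trans _ aie)// /norm1 (bigD1 j)//= lerDl sumr_ge0.
  have := Zunif i _ (measurable_overlap eps (a i)); rewrite /distribution /pushforward => ->.
  rewrite uniform_overlap// => [|j]; last by rewrite (le_trans (aije j))//; lra.
  rewrite lee_fin /x /norm1 mulr_suml; apply: weierstrass_product => j _.
  by rewrite divr_ge0 ?(ltW e2)//= ler_pdivrMr// mul1r (le_trans (aije j))//; lra.
have x_sum : \sum_(i <- iota 0 k) x i <= 2^-1.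
  rewrite -mulr_suml -[X in iota 0 X]subn0 -/(index_iota 0 k) big_mkord ler_pdivrMr//.
  by rewrite mulKf.
have x01 : {in iota 0 k, forall i, 0 <= x i <= 1}.
  move=> i; rewrite mem_iota => /andP[_ ik].
  rewrite divr_ge0 ?(ltW e2)//= ler_pdivrMr// mul1r (@le_trans _ _ eps)//; last by lra.
  rewrite (le_trans _ ae)// (bigD1 (Ordinal ik))//= lerDl.
  by apply: sumr_ge0 => l _; exact: norm1_ge0.
rewrite (Zind _ _ (iota_uniq 0 k) (fun i => measurable_overlap eps (a i))).
apply: (@le_trans _ _ (\prod_(i <- iota 0 k) (1 - x i))%:E).
  rewrite lee_fin (le_trans _ (weierstrass_product x01))//.
  lra.
apply: prode_ge_prod => i ik.
  by have /andP[] := x01 i ik; rewrite subr_ge0.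
by apply: prob_i; move: ik; rewrite mem_iota => /andP[].
Qed.

End Noise.

(** The integral of a nonnegative function is the supremum of the integrals of
    the simple functions below it, hence monotone even when [X] is not measurable. *)
Lemma expectation_ge {R : realType} d (T : measurableType d) (P : probability T R)
    (X : T -> R) (G : set T) (rho : R) :
  measurable G -> 0 <= rho -> (forall w, 0 <= X w) -> (forall w, G w -> rho <= X w) ->
  (rho%:E * P G <= 'E_P[X])%E.
Proof.
move=> mG rho0 X0 GX; rewrite unlock.
have -> : (rho%:E * P G = \int[P]_w (rho * \1_G w)%:E)%E.
  under eq_integral do rewrite EFinM.
  rewrite ge0_integralZl_EFin//=.
  - by rewrite integral_indic// setIT.
  - by apply/measurable_EFinP; exact: measurable_indic.
rewrite !ge0_integralTE; last 2 first.
- by move=> x; rewrite lee_fin.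
- by move=> x; rewrite lee_fin mulr_ge0// indicE.
apply: le_ereal_sup => _ [h hG <-]; exists h => // w.
rewrite (le_trans (hG w))// lee_fin indicE.
case: (boolP (w \in G)); rewrite ?inE => wG; last by rewrite mulr0.
by rewrite mulr1 GX.
Qed.

(** * The diameter of the support *)

Section Norm1.
Context {R : realType}.

Lemma norm1_ge0 n (v : 'rV[R]_n) : 0 <= norm1 v.
Proof. exact: sumr_ge0. Qed.

Lemma norm1Z n (a : R) (v : 'rV[R]_n) : norm1 (a *: v) = `|a| * norm1 v.
Proof. by rewrite /norm1 mulr_sumr; apply: eq_bigr => i _; rewrite mxE normrM. Qed.

Lemma norm1N n (v : 'rV[R]_n) : norm1 (- v) = norm1 v.
Proof. by apply: eq_bigr => i _; rewrite mxE normrN. Qed.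

Lemma norm1_eq0 n (v : 'rV[R]_n) : norm1 v = 0 -> v = 0.
Proof.
move=> v0; apply/eqP; rewrite -normr_eq0 eq_le normr_ge0 andbT -v0.
exact: norm_norm1.
Qed.

Lemma opnorm1_has_sup m n (H : 'M[R]_(m, n)) :
  has_sup [set norm1 (v *m H^T) | v in [set v : 'rV[R]_n | norm1 v <= 1]].
Proof.
split.
  exists (norm1 (0 *m H^T)), 0 => //=.
  by rewrite /norm1 big1// => i _; rewrite mxE normr0.
have [g g0 gP] := linear_bounded (mulmxr H^T : {linear 'rV[R]_n -> 'rV[R]_m}).
exists (m%:R * g) => _ [v /= v1 <-].
rewrite (le_trans (norm1_norm _))// ler_wpM2l//.
rewrite (le_trans (gP v))// ler_piMr//; exact: le_trans (norm_norm1 v) v1.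
Qed.

Lemma opnorm1_ge0 m n (H : 'M[R]_(m, n)) : 0 <= opnorm1 H.
Proof.
have [[_ [v v1 _]] Hub] := opnorm1_has_sup H.
by apply: (le_trans (norm1_ge0 (v *m H^T))); apply: ub_le_sup => //; exists v.
Qed.

Lemma norm1_mul_le m n (H : 'M[R]_(m, n)) (v : 'rV[R]_n) :
  norm1 (v *m H^T) <= opnorm1 H * norm1 v.
Proof.
have [v0|v0] := eqVneq (norm1 v) 0.
  rewrite (norm1_eq0 v0) mul0mx [leLHS](_ : _ = 0) ?mulr_ge0 ?norm1_ge0 ?opnorm1_ge0//.
  by rewrite /norm1 big1// => i _; rewrite mxE normr0.
have vpos : 0 < norm1 v by rewrite lt_neqAle eq_sym v0 norm1_ge0.
rewrite -ler_pdivrMr// mulrC -[_^-1]gtr0_norm ?invr_gt0// -norm1Z scalemxAl.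
apply: ub_le_sup; first by have [] := opnorm1_has_sup H.
exists ((norm1 v)^-1 *: v) => //=.
by rewrite norm1Z gtr0_norm ?invr_gt0// mulVf.
Qed.

Lemma diam1_ge0 n (S : set 'rV[R]_n) : 0 <= diam1 S.
Proof.
rewrite /diam1; set D := [set _ | _ in _].
have [[[x Dx] Dub]|nsup] := pselect (has_sup D); last by rewrite sup_out.
have [p _ px] := Dx; apply: (@le_trans _ _ x); first by rewrite -px norm1_ge0.
exact: ub_le_sup.
Qed.

(** The bound on [S] is essential, since a real-valued supremum is [0] on unbounded
    sets. *)
Lemma le_diam1 n (S : set 'rV[R]_n) (c : R) (x y : 'rV[R]_n) :
  (forall v, S v -> `|v| <= c) -> S x -> S y -> norm1 (x - y) <= diam1 S.
Proof.
move=> Sc Sx Sy; apply: ub_le_sup; last by exists (x, y).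
exists (n%:R * (c + c)) => _ [[v w] /= [Sv Sw] <-].
rewrite (le_trans (norm1_norm _))// ler_wpM2l//.
by rewrite (le_trans (ler_normB _ _))// lerD// Sc.
Qed.

End Norm1.

Lemma uniform_density_neq0 (R : realType) m (eps : R) (z : 'rV[R]_m) : 0 < eps ->
  (forall j, `|z 0 j| <= eps) -> uniform_density eps z != 0.
Proof.
move=> e0 ze; apply/prodf_neq0 => j _; rewrite /uniform_pdf -ler_norml ze.
by rewrite invr_neq0// opprK gt_eqF// addr_gt0.
Qed.

Section Support.
Context {R : realType} {n m : nat}.
Variables (A : {linear 'rV[R]_n -> 'rV[R]_n})
  (B : {bilinear 'rV[R]_n -> 'rV[R]_n -> 'rV[R]_n}) (f : 'rV[R]_n).
Variables (r delta h : R).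
Hypotheses (r_gt0 : 0 < r) (delta_gt0 : 0 < delta) (h_gt0 : 0 < h).
Hypothesis trap : trapping A B f r delta.
Hypothesis sol_ex : forall v, eball r v -> exists x, solution A B f v x.
Variables (H : 'M[R]_(m, n)) (eta : 'rV[R]_m -> R) (q : 'rV[R]_n -> R)
  (mu : forall k, ('I_k.+1 -> 'rV[R]_m) -> 'rV[R]_n -> R).
Hypothesis mu_fi : is_filtering_density A B f r h H eta q mu.

Lemma obs_time_ge0 k : 0 <= obs_time h k.
Proof. by rewrite mulr_ge0// ltW. Qed.

Lemma filtering_supp k (Y : 'I_k.+1 -> 'rV[R]_m) b : eball r b -> 0 < q b ->
  (forall i : 'I_k.+1, eta (Y i - flow A B f (obs_time h i) b *m H^T) != 0) ->
  density_supp (mu Y) (flow A B f (obs_time h k) b).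
Proof.
move=> br qb Yb; have t0 := obs_time_ge0 k.
have [c c0 muE] := mu_fi Y.
rewrite /density_supp /= muE; apply: mulf_neq0; first by rewrite gt_eqF.
rewrite /filtering_weight ifT; last first.
  by rewrite inE; exists b.
rewrite /= (flow_invK r_gt0 delta_gt0 trap sol_ex t0 br).
apply: mulf_neq0; last by rewrite gt_eqF.
apply: mulf_neq0; first by apply/prodf_neq0.
exact: (det_flow_inv_jacobian r_gt0 delta_gt0 trap sol_ex).
Qed.

Lemma filtering_supp_bounded k (Y : 'I_k.+1 -> 'rV[R]_m) w :
  density_supp (mu Y) w -> `|w| <= r.
Proof.
have [c _ muE] := mu_fi Y; rewrite /density_supp /= muE /filtering_weight.
case: ifPn => [|_]; last by rewrite mulr0 eqxx.
rewrite inE => -[b br <-] _; apply: eball_norm; first exact: ltW.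
exact: (flow_eball r_gt0 delta_gt0 trap sol_ex br (obs_time_ge0 k)).
Qed.

End Support.

Theorem theorem3p2 (R : realType) (n m : nat)
  (A : {linear 'rV[R]_n -> 'rV[R]_n})
  (B : {bilinear 'rV[R]_n -> 'rV[R]_n -> 'rV[R]_n}) (f : 'rV[R]_n)
  (r delta h : R) (r_gt0 : 0 < r) (delta_gt0 : 0 < delta) (h_gt0 : 0 < h)
  (trap : trapping A B f r delta)
  (sol_ex : forall v, eball r v -> exists x, solution A B f v x)
  (H : 'M[R]_(m, n))
  (q : 'rV[R]_n -> R) (q_density : is_density q)
  (q_ball : forall v, ~ eball r v -> q v = 0)
  (u : 'rV[R]_n) (u_ball : eball r u)
  (U : nat -> set 'rV[R]_n) (C dmax : nat -> R)
  (U_dist : forall k,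
    [set norm1 (flow A B f (obs_time h k) v - flow A B f (obs_time h k) u)
      | v in U k] = `[0, dmax k]%classic)
  (U_sum : forall k v, U k v ->
    \sum_(i < k.+1)
      norm1 (flow A B f (obs_time h i) v - flow A B f (obs_time h i) u)
    <= C k * norm1 (flow A B f (obs_time h k) v - flow A B f (obs_time h k) u))
  (idx : nat -> nat) (idx_incr : {homo idx : i j / (i < j)%N})
  (CU dU : R) (dU_gt0 : 0 < dU)
  (C_le : forall j, C (idx j) <= CU) (dmax_ge : forall j, dU <= dmax (idx j))
  (q_gt0 : forall v, (\bigcup_k U k) v -> 0 < q v)
  (eps : R) (eps_gt0 : 0 < eps) (eps_le : eps <= dU * CU * opnorm1 H)
  (dT : measure_display) (T : measurableType dT) (P : probability T R)
  (Z : nat -> {RV P >-> borelV m})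
  (Z_indep : mutually_independent P Z)
  (Z_unif : forall i, has_density P (Z i) (uniform_density eps))
  (mu : forall k, ('I_k.+1 -> 'rV[R]_m) -> 'rV[R]_n -> R)
  (mu_fi : is_filtering_density A B f r h H (uniform_density eps) q mu)
  (j : nat) :
  (((expR 1)^-1 * (eps / (CU * opnorm1 H)))%:E <=
   'E_P[fun w => diam1 (density_supp (mu (idx j)
          (fun i : 'I_(idx j).+1 =>
             (flow A B f (obs_time h i) u *m H^T + Z i w)%R)))])%E.
Proof.
set k := idx j; pose t := obs_time h k.
set rho := eps / (CU * opnorm1 H).
have CH_gt0 : 0 < CU * opnorm1 H.
  by rewrite -(pmulr_rgt0 _ dU_gt0) mulrA; exact: lt_le_trans eps_le.
have rho_gt0 : 0 < rho by rewrite divr_gt0.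
have rho_le : rho <= dmax k.
  by rewrite (le_trans _ (dmax_ge j))// ler_pdivrMr// mulrA.
have UB v : U k v -> eball r v /\ 0 < q v.
  move=> Uv; have qv : 0 < q v by apply: q_gt0; exists k.
  by split=> //; apply: contrapT => /q_ball qv0; rewrite qv0 ltxx in qv.
have attained d : 0 <= d <= dmax k -> exists2 v, U k v &
    norm1 (flow A B f t v - flow A B f t u) = d.
  move=> dk; have : `[0, dmax k]%classic d by rewrite /= in_itv.
  by rewrite -U_dist => -[v Uv vd]; exists v.
(* v is a point of the anti-leaf set at distance exactly rho at the final time *)
have [v Uv vrho] : exists2 v, U k v & norm1 (flow A B f t v - flow A B f t u) = rho.
  by apply: attained; rewrite ltW.
have [vr qv] := UB v Uv.
(* the point of U k at distance 0 is u itself, by injectivity of the flow *)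
have qu : 0 < q u.
  have [|u' Uu' u'0] := attained 0.
    by rewrite lexx/= (le_trans _ rho_le)// ltW.
  have [u'r qu'] := UB u' Uu'.
  move/norm1_eq0/eqP : u'0; rewrite subr_eq0 => /eqP.
  by move/(flow_inj r_gt0 delta_gt0 trap sol_ex (obs_time_ge0 h_gt0 k) u'r u_ball) => <-.
pose a i := (flow A B f (obs_time h i) u - flow A B f (obs_time h i) v) *m H^T.
have a_sum : \sum_(i < k.+1) norm1 (a i) <= eps.
  apply: (@le_trans _ _ (opnorm1 H * (CU * rho))); last first.
    by rewrite mulrA [opnorm1 H * CU]mulrC [leLHS]mulrC divfK ?gt_eqF.
  apply: (@le_trans _ _ (opnorm1 H * \sum_(i < k.+1)
      norm1 (flow A B f (obs_time h i) v - flow A B f (obs_time h i) u))).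
    rewrite mulr_sumr; apply: ler_sum => i _.
    by rewrite -[X in _ * X]norm1N opprB norm1_mul_le.
  rewrite ler_wpM2l ?opnorm1_ge0// (le_trans (U_sum k v Uv))// -/t vrho.
  by rewrite ler_wpM2r ?C_le// ltW.
pose G := \bigcap_(i in [set` iota 0 k.+1]) Z i @^-1` overlap eps (a i).
have mG : measurable G.
  apply: fin_bigcap_measurable => [|i _]; first exact: finite_seq.
  by rewrite -[X in measurable X]setTI; apply: measurable_funPT => //; exact: measurable_overlap.
have PG := prob_overlap eps_gt0 Z_indep Z_unif a_sum.
(* on G, both the true state and the state reached from v are in the support *)
apply: (@le_trans _ _ (rho%:E * P G)%E); last first.
  apply: expectation_ge => //; [exact: ltW | by move=> w; exact: diam1_ge0 |].
  move=> w Gw; rewrite -vrho.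
  have Gi (i : 'I_k.+1) l : `|Z i w 0 l| <= eps /\ `|Z i w 0 l + a i 0 l| <= eps.
    have ik : (i : nat) \in iota 0 k.+1 by rewrite mem_iota ltn_ord.
    exact: (Gw i ik l).
  apply: le_diam1.
  - by move=> x; exact: (filtering_supp_bounded r_gt0 delta_gt0 h_gt0 trap sol_ex mu_fi).
  - apply: (filtering_supp r_gt0 delta_gt0 h_gt0 trap sol_ex mu_fi) => // i.
    apply: uniform_density_neq0 => // l.
    by rewrite addrAC -mulmxBl addrC mxE; have [] := Gi i l.
  - apply: (filtering_supp r_gt0 delta_gt0 h_gt0 trap sol_ex mu_fi) => // i.
    apply: uniform_density_neq0 => // l.
    by rewrite addrAC subrr add0r; have [] := Gi i l.
apply: (@le_trans _ _ (rho%:E * (2^-1)%:E)%E); last by rewrite lee_pmul2l// lte_fin.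
rewrite -EFinM lee_fin mulrC ler_wpM2l ?(ltW rho_gt0)// lef_pV2 ?posrE ?expR_gt0//.
by rewrite (le_trans _ (expR_ge1Dx 1)).
Qed.
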